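(* Let $V$ be a quantale and let $(\mathbb T,\tau)$ be a $V$-power-enriched monad, with $\mathbb T=(T,m,e)$. The Kleisli extension $\check T$ of $T$ to $V\text{-}\mathsf{Rel}$ (with respect to $\tau$) yields a lax extension $\check{\mathbb T}=(\check T,m,e)$ of $\mathbb T$ to $V\text{-}\mathsf{Rel}$. Moreover, $\check T$ preserves composition of $V$-relations, that is, $\check T(s\cdot r)=\check Ts\cdot\check Tr$ for all $V$-relations $r:X\nrightarrow Y$ and $s:Y\nrightarrow Z$.
   Context: **$V$-relations.** A quantale $V=(V,\otimes,k)$ is a complete lattice with an associative (not necessarily commutative) operation $\otimes$ preserving suprema in each variable and with neutral element $k$; $\bot$ is its least element. A $V$-relation $r:X\nrightarrow Y$ is a map $r:X\times Y\to V$; composition with $s:Y\nrightarrow Z$ is $(s\cdot r)(x,z)=\bigvee_{y}r(x,y)\otimes s(y,z)$, and $1_X(x,y)=k$ if $x=y$, $\bot$ otherwise. This gives the category $V\text{-}\mathsf{Rel}$, with hom-sets ordered pointwise. The opposite is $r^\circ(y,x)=r(x,y)$. A map $f:X\to Y$ is also regarded as the $V$-relation with $f(x,y)=k$ if $f(x)=y$, $\bot$ otherwise; $f^\circ:Y\nrightarrow X$ is its opposite. $1=\{\star\}$ is a singleton and $x\in X$ is identified with the map $x:1\to X$. **Lax extensions.** A lax extension of a monad $\mathbb T=(T,m,e)$ on $\mathsf{Set}$ to $V\text{-}\mathsf{Rel}$ is given by functions $\hat T:V\text{-}\mathsf{Rel}(X,Y)\to V\text{-}\mathsf{Rel}(TX,TY)$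 for all sets $X,Y$ with: $r\le r'\Rightarrow\hat Tr\le\hat Tr'$; $(Tf)^\circ\le\hat T(f^\circ)$; $\hat T(f^\circ\cdot r)=(Tf)^\circ\cdot\hat Tr$; $\hat Ts\cdot\hat Tr\le\hat T(s\cdot r)$; $\hat T\hat Tr\cdot m_X^\circ\le m_Y^\circ\cdot\hat Tr$; $r\cdot e_X^\circ\le e_Y^\circ\cdot\hat Tr$, for all $V$-relations $r,r':X\nrightarrow Y$, $s:Y\nrightarrow Z$ and maps $f:Z\to Y$. **$V$-power-enriched monads.** The $V$-powerset monad $\mathbb P_V=(P_V,\mu,\eta)$ on $\mathsf{Set}$ has $P_VX=V\text{-}\mathsf{Rel}(X,1)$, $P_Vf(r)=r\cdot f^\circ$, $\eta_X(x)=x^\circ$, $\mu_X(R)=R\cdot\mathrm{ev}_X$ with $\mathrm{ev}_X:X\nrightarrow P_VX$, $\mathrm{ev}_X(x,r)=r(x,\star)$. A $\mathbb P_V$-algebra $(X,a)$ is the same as a complete lattice $X$ with a right $V$-action $*:X\times V\to X$ preserving suprema in each variable with $x*(v\otimes u)=(x*v)*u$, $x*k=x$; here $a(\phi)=\bigvee_x x*\phi(x,\star)$. A monad morphism $\tau:\mathbb P_V\to\mathbb T$ makes each $TX$ a $\mathbb P_V$-algebra via $m_X\cdot\tau_{TX}:P_VTX\to TX$, hence a complete lattice with right $V$-action. The pair $(\mathbb T,\tau)$ is a $V$-power-enriched monad if for all $f,g:X\to TY$, $f\le g$ pointwise implies $m_Y\cdot Tf\le m_Y\cdot Tg$ pointwise.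 **Kleisli extension.** For $\mathfrak x,\mathfrak y\in TX$ put $[\mathfrak x,\mathfrak y]:=\bigvee\{v\in V\mid\mathfrak x*v\le\mathfrak y\}$. For $r:X\nrightarrow Y$, let $r^\flat:Y\to P_VX$, $r^\flat(y)=r(-,y)$, and $r^\tau:=m_X\cdot T(\tau_X\cdot r^\flat):TY\to TX$. The Kleisli extension $\check T$ with respect to $\tau$ is given by $\check Tr(\mathfrak x,\mathfrak y):=[\mathfrak x,r^\tau(\mathfrak y)]$ for all $r:X\nrightarrow Y$, $\mathfrak x\in TX$, $\mathfrak y\in TY$. *)

(* Defs.v *)
From HB Require Import structures.
From mathcomp Require Import all_boot all_order.
From mathcomp Require Import boolp classical_sets.

Set Implicit Arguments.
Unset Strict Implicit.
Unset Printing Implicit Defensive.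

Import Order.TTheory.
Local Open Scope order_scope.
Local Open Scope classical_set_scope.

HB.mixin Record hasSup d T of Order.TBLattice d T := {
  qsup : set T -> T;
  qsup_supremums : forall A : set T, supremums A (qsup A)
}.

#[short(type="completeLatticeType")]
HB.structure Definition CompleteLattice d :=
  { T of hasSup d T & Order.TBLattice d T }.

HB.mixin Record isQuantale d V of CompleteLattice d V := {
  qmul : V -> V -> V;
  qone : V;
  qmulA : associative qmul;
  qmul1q : left_id qone qmul;
  qmulq1 : right_id qone qmul;
  qmul_supl : forall (A : set V) (v : V),
    qmul (qsup A) v = qsup [set qmul u v | u in A];
  qmul_supr : forall (v : V) (A : set V),
    qmul v (qsup A) = qsup [set qmul v u | u in A]
}.

#[short(type="quantaleType")]
HB.structure Definition Quantale d :=
  { V of isQuantale d V & CompleteLattice d V }.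

Arguments qone {d s}.

Section VRel.
Context {d : Order.disp_t} {V : quantaleType d}.

Definition vrel (X Y : Type) := X -> Y -> V.

Definition vrel_le X Y (r r' : vrel X Y) := forall x y, (r x y <= r' x y)%O.

(* Diagrammatically [r] comes first; the tensor keeps this left-to-right order,
   which matters since it need not be commutative. *)
Definition vcomp X Y Z (s : vrel Y Z) (r : vrel X Y) : vrel X Z :=
  fun x z => qsup (range (fun y => qmul (r x y) (s y z))).

Definition vgraph X Y (f : X -> Y) : vrel X Y :=
  fun x y => if `[< f x = y >] then qone else \bot.

Definition vid X : vrel X X :=
  fun x y => if `[< x = y >] then qone else \bot.

Definition vop X Y (r : vrel X Y) : vrel Y X := fun y x => r x y.

End VRel.

Arguments vrel {d} V X Y.
Arguments vid {d} V X.

Record monad := Monad {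
  mobj :> Type -> Type;
  mmap : forall X Y, (X -> Y) -> mobj X -> mobj Y;
  munit : forall X, X -> mobj X;
  mmult : forall X, mobj (mobj X) -> mobj X;
  mmap_id : forall X, mmap (@idfun X) = idfun;
  mmap_comp : forall X Y Z (g : Y -> Z) (f : X -> Y),
    mmap (g \o f) = mmap g \o mmap f;
  munit_nat : forall X Y (f : X -> Y), mmap f \o @munit X = @munit Y \o f;
  mmult_nat : forall X Y (f : X -> Y),
    mmap f \o @mmult X = @mmult Y \o mmap (mmap f);
  mmult_unitl : forall X, @mmult X \o @munit (mobj X) = idfun;
  mmult_unitr : forall X, @mmult X \o mmap (@munit X) = idfun;
  mmult_assoc : forall X, @mmult X \o @mmult (mobj X) = @mmult X \o mmap (@mmult X)
}.

Arguments mmap T {X Y} f : rename.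
Arguments munit T {X} x : rename.
Arguments mmult T {X} t : rename.

Record monad_morphism (S T : monad) := MonadMorphism {
  mtrans :> forall X, S X -> T X;
  mtrans_nat : forall X Y (f : X -> Y),
    mmap T f \o @mtrans X = @mtrans Y \o mmap S f;
  mtrans_unit : forall X, @mtrans X \o munit S = munit T;
  mtrans_mult : forall X,
    @mtrans X \o mmult S = mmult T \o mmap T (@mtrans X) \o @mtrans (S X)
}.

Record is_algebra (T : monad) (X : Type) (a : T X -> X) : Prop := IsAlgebra {
  algebra_unit : a \o munit T = idfun;
  algebra_mult : a \o mmult T = a \o mmap T a
}.

Section VPowerset.
Context {d : Order.disp_t} (V : quantaleType d).

Definition pv_obj (X : Type) : Type := vrel V X unit.

Definition pv_map X Y (f : X -> Y) (r : pv_obj X) : pv_obj Y :=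
  vcomp r (vop (vgraph f)).

Definition pv_unit X (x : X) : pv_obj X := vop (vgraph (fun _ : unit => x)).

Definition pv_ev X : vrel V X (pv_obj X) := fun x r => r x tt.

Definition pv_mult X (R : pv_obj (pv_obj X)) : pv_obj X := vcomp R (@pv_ev X).

End VPowerset.

Section VRelTheory.
Context {d : Order.disp_t} {V : quantaleType d}.
Implicit Types (A B : set V) (u v w : V).

Lemma qsup_ub A v : A v -> v <= qsup A.
Proof. by case: (qsup_supremums A) => ub _; apply: ub. Qed.

Lemma qsup_le A w : (forall v, A v -> v <= w) -> qsup A <= w.
Proof. by case: (qsup_supremums A) => _ lb Aw; apply: lb. Qed.

Lemma qsup_eq A w :
  (forall v, A v -> v <= w) -> (forall u, (forall v, A v -> v <= u) -> w <= u) ->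
  qsup A = w.
Proof.
move=> h1 h2; apply/eqP; rewrite eq_le qsup_le //=.
by apply: h2 => v; apply: qsup_ub.
Qed.

Lemma qsup0 : qsup (set0 : set V) = \bot.
Proof. by apply: qsup_eq => // u _; apply: le0x. Qed.

Lemma qmul0q v : qmul \bot v = \bot.
Proof. by rewrite -qsup0 qmul_supl image_set0. Qed.

Lemma qmulq0 v : qmul v \bot = \bot.
Proof. by rewrite -qsup0 qmul_supr image_set0. Qed.

Lemma qsup_rangeA (I J : Type) (F : I -> J -> V) :
  qsup (range (fun i => qsup (range (F i)))) =
  qsup (range (fun j => qsup (range (fun i => F i j)))).
Proof.
apply/eqP; rewrite eq_le; apply/andP; split.
  apply: qsup_le => _ [i _ <-]; apply: qsup_le => _ [j _ <-].
  apply: (@le_trans _ _ (qsup (range (fun i => F i j)))); apply: qsup_ub.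
    by exists i.
  by exists j.
apply: qsup_le => _ [j _ <-]; apply: qsup_le => _ [i _ <-].
apply: (@le_trans _ _ (qsup (range (F i)))); apply: qsup_ub.
  by exists j.
by exists i.
Qed.

Lemma qmul_range_supl (I : Type) (F : I -> V) v :
  qmul (qsup (range F)) v = qsup (range (fun i => qmul (F i) v)).
Proof. by rewrite qmul_supl image_comp. Qed.

Lemma qmul_range_supr (I : Type) (F : I -> V) v :
  qmul v (qsup (range F)) = qsup (range (fun i => qmul v (F i))).
Proof. by rewrite qmul_supr image_comp. Qed.

Lemma qsup_range_single (I : Type) (F : I -> V) (i : I) :
  (forall j, j <> i -> F j = \bot) -> qsup (range F) = F i.
Proof.
move=> Fb; apply: qsup_eq; last by move=> u; apply; exists i.
move=> _ [j _ <-]; have [->//|ji] := pselect (j = i).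
by rewrite Fb // le0x.
Qed.

Lemma eq_qsup_range (I : Type) (F G : I -> V) :
  (forall i, F i = G i) -> qsup (range F) = qsup (range G).
Proof. by move=> /funext ->. Qed.

Lemma vrelP X Y (r s : vrel V X Y) : (forall x y, r x y = s x y) -> r = s.
Proof. by move=> rs; apply/funext => x; apply/funext => y. Qed.

Lemma vcompA X Y Z W (t : vrel V Z W) (s : vrel V Y Z) (r : vrel V X Y) :
  vcomp t (vcomp s r) = vcomp (vcomp t s) r.
Proof.
apply: vrelP => x w; rewrite /vcomp.
under eq_fun do rewrite qmul_range_supl.
rewrite qsup_rangeA; apply: eq_qsup_range => y.
by rewrite qmul_range_supr; apply: eq_qsup_range => z; rewrite qmulA.
Qed.

Lemma vcomp_graphr X Y Z (r : vrel V Y Z) (f : X -> Y) x z :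
  vcomp r (vgraph f) x z = r (f x) z.
Proof.
rewrite /vcomp (@qsup_range_single _ _ (f x)).
  by rewrite /vgraph asboolT // qmul1q.
by move=> y yfx; rewrite /vgraph asboolF ?qmul0q // => /esym.
Qed.

Lemma vcomp_opl X Y Z (f : Z -> Y) (r : vrel V X Y) x z :
  vcomp (vop (vgraph f)) r x z = r x (f z).
Proof.
rewrite /vcomp (@qsup_range_single _ _ (f z)).
  by rewrite /vop /vgraph asboolT // qmulq1.
by move=> y yfz; rewrite /vop /vgraph asboolF ?qmulq0 // => /esym.
Qed.

Lemma vcomp1r X Y (r : vrel V X Y) : vcomp (vid V Y) r = r.
Proof.
apply: vrelP => x y; rewrite /vcomp (@qsup_range_single _ _ y).
  by rewrite /vid asboolT // qmulq1.
by move=> z zy; rewrite /vid asboolF ?qmulq0.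
Qed.

Lemma vcompr1 X Y (r : vrel V X Y) : vcomp r (vid V X) = r.
Proof. by apply: vrelP => x y; rewrite (vcomp_graphr _ idfun). Qed.

Lemma vop_graph_comp X Y Z (g : Y -> Z) (f : X -> Y) :
  vcomp (vop (vgraph f)) (vop (vgraph g)) = vop (vgraph (g \o f)) :> vrel V Z X.
Proof. by apply: vrelP => z x; rewrite vcomp_opl. Qed.

Lemma vop_graph_id X : vop (vgraph (@idfun X)) = vid V X.
Proof.
apply: vrelP => x y; rewrite /vop /vgraph /vid.
by congr (if _ then _ else _); apply: asbool_equiv_eq; split=> /esym.
Qed.

Lemma pv_map_id X : pv_map (@idfun X) = @idfun (pv_obj V X).
Proof. by apply/funext => r; rewrite /pv_map vop_graph_id vcompr1. Qed.

Lemma pv_map_comp X Y Z (g : Y -> Z) (f : X -> Y) :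
  pv_map (g \o f) = pv_map g \o pv_map f :> (pv_obj V X -> pv_obj V Z).
Proof. by apply/funext => r; rewrite /pv_map /= -vop_graph_comp vcompA. Qed.

Lemma pv_unit_nat X Y (f : X -> Y) :
  pv_map f \o @pv_unit d V X = @pv_unit d V Y \o f.
Proof. by apply/funext => x; rewrite /pv_map /pv_unit /= vop_graph_comp. Qed.

Lemma pv_ev_op X Y (f : Y -> pv_obj V X) x y :
  vcomp (vop (vgraph f)) (@pv_ev d V X) x y = f y x tt.
Proof. by rewrite vcomp_opl. Qed.

Lemma pv_mult_nat X Y (f : X -> Y) :
  pv_map f \o @pv_mult d V X = @pv_mult d V Y \o pv_map (pv_map f).
Proof.
apply/funext => R; rewrite /pv_map /pv_mult /= -!vcompA; congr vcomp.
by apply: vrelP => y r; rewrite pv_ev_op.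
Qed.

Lemma pv_mult_unitl X : @pv_mult d V X \o @pv_unit d V _ = idfun.
Proof.
apply/funext => r; rewrite /pv_mult /pv_unit /=.
by apply: vrelP => x []; rewrite pv_ev_op.
Qed.

Lemma pv_mult_unitr X : @pv_mult d V X \o pv_map (@pv_unit d V X) = idfun.
Proof.
apply/funext => r; rewrite /pv_mult /pv_map /= -vcompA -[RHS]vcompr1; congr vcomp.
apply: vrelP => x y; rewrite pv_ev_op /pv_unit /vop /vgraph /vid.
by congr (if _ then _ else _); apply: asbool_equiv_eq; split=> /esym.
Qed.

Lemma pv_mult_assoc X :
  @pv_mult d V X \o @pv_mult d V _ = @pv_mult d V X \o pv_map (@pv_mult d V X).
Proof.
apply/funext => R; rewrite /pv_mult /pv_map /= -!vcompA; congr vcomp.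
by apply: vrelP => x r; rewrite pv_ev_op.
Qed.

End VRelTheory.

Definition pv_monad d (V : quantaleType d) : monad :=
  Monad (@pv_map_id d V) (@pv_map_comp d V) (@pv_unit_nat d V)
        (@pv_mult_nat d V) (@pv_mult_unitl d V) (@pv_mult_unitr d V)
        (@pv_mult_assoc d V).

Definition is_lub X (le : X -> X -> Prop) (A : set X) (s : X) : Prop :=
  (forall x, A x -> le x s) /\
  (forall y, (forall x, A x -> le x y) -> le s y).

Record is_vmodule d (V : quantaleType d) (X : Type)
    (le : X -> X -> Prop) (act : X -> V -> X) : Prop := IsVModule {
  vmodule_refl : forall x, le x x;
  vmodule_anti : forall x y, le x y -> le y x -> x = y;
  vmodule_trans : forall x y z, le x y -> le y z -> le x z;
  vmodule_sup : forall A : set X, exists s, is_lub le A s;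
  vmodule_act_supl : forall (A : set X) s v,
    is_lub le A s -> is_lub le [set act x v | x in A] (act s v);
  vmodule_act_supr : forall x (W : set V),
    is_lub le [set act x v | v in W] (act x (qsup W));
  vmodule_act_mul : forall x u v, act x (qmul v u) = act (act x v) u;
  vmodule_act_one : forall x, act x qone = x
}.

Section AlgebraStructure.
Context {d : Order.disp_t} {V : quantaleType d} (X : Type) (a : pv_obj V X -> X).

(* The supremum, order and action read off from the structure map [a]; that
   they form the unique complete lattice with right action such that [a phi]
   is the supremum of the [x * phi x] is [algebra_vmodule], [algebra_lub],
   [algebra_le_unique] and [algebra_act_unique] below. *)
Definition alg_sup (A : set X) : X :=
  a (fun x _ => if `[< A x >] then qone else \bot).

Definition alg_le (x y : X) : Prop := alg_sup [set x; y] = y.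

Definition alg_act (x : X) (v : V) : X :=
  a (fun x' _ => if `[< x' = x >] then v else \bot).

Hypothesis aP : @is_algebra (pv_monad V) X a.

Lemma algebra_family (I : Type) (psi : I -> pv_obj V X) (v : I -> V) :
  a (fun x _ => qsup (range (fun i => qmul (psi i x tt) (v i)))) =
  a (fun x _ => qsup [set v i | i in [set i | a (psi i) = x]]).
Proof.
pose R : pv_obj V (pv_obj V X) := fun p _ => qsup [set v i | i in [set i | psi i = p]].
have := congr1 (@^~ R) (algebra_mult aP); rewrite /= => aR.
transitivity (a (pv_mult R)).
  congr a; apply: vrelP => x []; rewrite /pv_mult /vcomp /pv_ev /R.
  apply/eqP; rewrite eq_le; apply/andP; split; apply: qsup_le => _ [i _ <-].
    apply: (@le_trans _ _ (qmul (psi i x tt) (qsup [set v j | j in [set j | psi j = psi i]]))).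
      by rewrite qmul_supr; apply: qsup_ub; exists (v i) => //; exists i.
    by apply: qsup_ub; exists (psi i).
  rewrite qmul_supr; apply: qsup_le => _ [_ [j <- <-] <-].
  by apply: qsup_ub; exists j.
rewrite aR; congr a; apply: vrelP => x []; rewrite /pv_map /vcomp /R.
apply/eqP; rewrite eq_le; apply/andP; split; apply: qsup_le.
  move=> _ [p _ <-]; rewrite /vop /vgraph; case: asboolP => [apx|_].
    rewrite qmul1q; apply: qsup_le => _ [i /= ip <-].
    by apply: qsup_ub; exists i => //=; rewrite ip.
  by rewrite qmul0q le0x.
move=> _ [i /= ix <-].
apply: (@le_trans _ _ (qsup [set v j | j in [set j | psi j = psi i]])).
  by apply: qsup_ub; exists i.
by apply: qsup_ub; exists (psi i) => //; rewrite /vop /vgraph asboolT // qmul1q.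
Qed.

Lemma algebra_sup_family (I : Type) (psi : I -> pv_obj V X) :
  a (fun x _ => qsup (range (fun i => psi i x tt))) = alg_sup (range (a \o psi)).
Proof.
transitivity (a (fun x _ => qsup (range (fun i => qmul (psi i x tt) qone)))).
  by congr a; apply: vrelP => x _; under [in RHS]eq_fun do rewrite qmulq1.
rewrite algebra_family; congr a; apply: vrelP => x _.
case: asboolP => [[i _ /= aix]|nax].
  apply: qsup_eq => [_ [j _ <-]//|u]; apply; by exists i.
rewrite -[RHS]qsup0; congr qsup; apply/seteqP; split => // _ [i /= aix _].
by case: nax; exists i.
Qed.

Lemma algebra_single (psi : pv_obj V X) v :
  a (fun x _ => qmul (psi x tt) v) = alg_act (a psi) v.
Proof.
have /= := algebra_family (fun _ : unit => psi) (fun _ => v).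
have -> : (fun x (_ : unit) => qsup (range (fun _ : unit => qmul (psi x tt) v))) =
          (fun x (_ : unit) => qmul (psi x tt) v).
  by apply: vrelP => x _; apply: (@qsup_range_single _ _ _ _ tt) => -[].
move=> ->; congr a; apply: vrelP => x _; case: asboolP => [->|nax].
  by apply: qsup_eq => [_ [j _ <-]//|u]; apply; exists tt.
rewrite -[RHS]qsup0; congr qsup; apply/seteqP; split => // _ [i /= aix _].
by case: nax.
Qed.

Lemma alg_sup1 x : alg_sup [set x] = x.
Proof.
rewrite -[RHS](congr1 (@^~ x) (algebra_unit aP)) /=; congr a; apply: vrelP => y u.
rewrite /= /pv_unit /vop /vgraph; congr (if _ then _ else _).
by apply: asbool_equiv_eq; split=> [->|/esym].
Qed.

Lemma alg_sup_bigcup (I : Type) (B : I -> set X) :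
  alg_sup (\bigcup_i B i) = alg_sup (range (alg_sup \o B)).
Proof.
rewrite -(algebra_sup_family (fun i x _ => if `[< B i x >] then qone else \bot)).
congr a; apply: vrelP => x _; case: asboolP => [[i _ Bix]|nB].
  apply/esym/qsup_eq => [_ [j _ <-]|u]; first by case: ifP => // _; apply: le0x.
  by apply; exists i => //; rewrite asboolT.
apply/esym/qsup_eq => [_ [j _ <-]|u _]; last exact: le0x.
by rewrite asboolF // => Bjx; apply: nB; exists j.
Qed.

Lemma alg_supU (A B : set X) : alg_sup (A `|` B) = alg_sup [set alg_sup A; alg_sup B].
Proof.
have -> : A `|` B = \bigcup_(b : bool) (if b then A else B).
  apply/seteqP; split => [x [Ax|Bx]|x [[] _ ?]]; by
    [exists true | exists false | left | right].
rewrite alg_sup_bigcup; congr alg_sup; apply/seteqP; split => x.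
  by case=> -[] _ <-; [left|right].
by case=> ->; [exists true|exists false].
Qed.

Lemma alg_le_refl x : alg_le x x.
Proof. by rewrite /alg_le setUid alg_sup1. Qed.

Lemma alg_le_anti x y : alg_le x y -> alg_le y x -> x = y.
Proof. by rewrite /alg_le setUC => -> ->. Qed.

Lemma alg_le_trans x y z : alg_le x y -> alg_le y z -> alg_le x z.
Proof.
rewrite /alg_le => xy yz; rewrite -{1}yz -{1}[x]alg_sup1 -alg_supU setUA.
by rewrite alg_supU xy alg_sup1.
Qed.

Lemma alg_supP (A : set X) : is_lub alg_le A (alg_sup A).
Proof.
split=> [x Ax|y Ay].
  rewrite /alg_le -{1}[x]alg_sup1 -alg_supU; congr alg_sup.
  by apply/setUidPr => _ ->.
rewrite /alg_le -{1}[y]alg_sup1 -alg_supU.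
pose B (o : option {x | A x}) := if o is Some x then [set sval x; y] else [set y].
have -> : A `|` [set y] = \bigcup_o B o.
  apply/seteqP; split => [x [Ax|->]|x [[o|] _]].
  - by exists (Some (exist _ x Ax)) => //; left.
  - by exists None.
  - by case: o => z Az /= [->|->]; [left|right].
  - by right.
rewrite alg_sup_bigcup -[RHS]alg_sup1; congr alg_sup; apply/seteqP; split => x.
  by case=> -[[z Az]|] _ <- /=; [exact: Ay|exact: alg_sup1].
by move=> ->; exists None => //=; exact: alg_sup1.
Qed.

Lemma is_lub_alg_sup (A : set X) s : is_lub alg_le A s -> s = alg_sup A.
Proof.
move=> [s1 s2]; have [t1 t2] := alg_supP A.
by apply: alg_le_anti; [apply: s2|apply: t2].
Qed.

Lemma algebra_sup_act (phi : pv_obj V X) :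
  a phi = alg_sup [set alg_act x (phi x tt) | x in setT].
Proof.
rewrite -(algebra_sup_family (fun x x' _ => if `[< x' = x >] then phi x tt else \bot)).
congr a; apply: vrelP => x []; rewrite (@qsup_range_single _ _ _ _ x).
  by rewrite asboolT.
by move=> y yx; rewrite asboolF // => /esym.
Qed.

Lemma algebra_lub (phi : pv_obj V X) :
  is_lub alg_le (range (fun x => alg_act x (phi x tt))) (a phi).
Proof. by rewrite algebra_sup_act; exact: alg_supP. Qed.

Lemma algebra_act_supr x (W : set V) :
  is_lub alg_le [set alg_act x v | v in W] (alg_act x (qsup W)).
Proof.
have -> : alg_act x (qsup W) = alg_sup [set alg_act x v | v in W]; last exact: alg_supP.
transitivity (alg_sup (range (fun w : {v | W v} => alg_act x (sval w)))).
  rewrite -(algebra_sup_family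
    (fun (w : {v | W v}) x' _ => if `[< x' = x >] then sval w else \bot)).
  congr a; apply: vrelP => x' _; case: asboolP => _.
    congr qsup; apply/seteqP; split => [v Wv|_ [[v Wv] _ <-]//].
    by exists (exist _ v Wv).
  by apply/esym/qsup_eq => [_ [j _ <-]//|u _]; exact: le0x.
congr alg_sup; apply/seteqP; split => [_ [[v Wv] _ <-]|_ [v Wv <-]].
  by exists v.
by exists (exist _ v Wv).
Qed.

Lemma algebra_act_supl (A : set X) s v :
  is_lub alg_le A s -> is_lub alg_le [set alg_act x v | x in A] (alg_act s v).
Proof.
move=> /is_lub_alg_sup ->.
have -> : alg_act (alg_sup A) v = alg_sup [set alg_act x v | x in A]; last exact: alg_supP.
rewrite -algebra_single.
transitivity (alg_sup (range (fun w : {x | A x} => alg_act (sval w) v))).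
  rewrite -(algebra_sup_family
    (fun (w : {x | A x}) x' _ => if `[< x' = sval w >] then v else \bot)).
  congr a; apply: vrelP => x _; case: asboolP => [Ax|nAx].
    rewrite qmul1q (@qsup_range_single _ _ _ _ (exist _ x Ax)) /=.
      by rewrite asboolT.
    move=> [y Ay] /= yx; rewrite asboolF // => xy; apply: yx.
    by subst y; congr exist; exact: Prop_irrelevance.
  rewrite qmul0q; apply/esym/qsup_eq => [_ [[y Ay] _ <-]|u _]; last exact: le0x.
  by rewrite asboolF //= => xy; apply: nAx; rewrite xy.
congr alg_sup; apply/seteqP; split => [_ [[x Ax] _ <-]|_ [x Ax <-]].
  by exists x.
by exists (exist _ x Ax).
Qed.

Lemma algebra_vmodule : is_vmodule alg_le alg_act.
Proof.
split; [exact: alg_le_refl|exact: alg_le_anti|exact: alg_le_trans| | | | | ].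
- by move=> A; exists (alg_sup A); exact: alg_supP.
- exact: algebra_act_supl.
- exact: algebra_act_supr.
- move=> x u v; rewrite -algebra_single; congr a; apply: vrelP => y _.
  by case: ifP => // _; rewrite qmul0q.
- exact: alg_sup1.
Qed.

Section Uniqueness.
Variables (le : X -> X -> Prop) (act : X -> V -> X).
Hypothesis Hm : is_vmodule le act.
Hypothesis Ha : forall phi : pv_obj V X,
  is_lub le (range (fun x => act x (phi x tt))) (a phi).

Let act0 x y : le (act x \bot) y.
Proof.
have [_] := vmodule_act_supr Hm x set0; rewrite qsup0; apply.
by move=> z [v []].
Qed.

Lemma algebra_le_unique x y : le x y <-> alg_le x y.
Proof.
have [ub lb] := Ha (fun z _ => if `[< [set x; y] z >] then qone else \bot).
have xs : le x (alg_sup [set x; y]).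
  apply: ub; exists x => //; rewrite asboolT; last by left.
  exact: (vmodule_act_one Hm).
have ys : le y (alg_sup [set x; y]).
  apply: ub; exists y => //; rewrite asboolT; last by right.
  exact: (vmodule_act_one Hm).
split=> [xy|<-//]; apply: (vmodule_anti Hm) => //; apply: lb => _ [z _ <-].
case: asboolP => [[]->|_]; last exact: act0.
  by rewrite (vmodule_act_one Hm).
by rewrite (vmodule_act_one Hm); exact: (vmodule_refl Hm).
Qed.

Lemma algebra_act_unique x v : act x v = alg_act x v.
Proof.
have [ub lb] := Ha (fun z _ => if `[< z = x >] then v else \bot).
apply: (vmodule_anti Hm); first by apply: ub; exists x => //; rewrite asboolT.
apply: lb => _ [z _ <-]; case: asboolP => [->|_]; first exact: (vmodule_refl Hm).
exact: act0.
Qed.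

End Uniqueness.

End AlgebraStructure.

Section PowerEnriched.
Context {d : Order.disp_t} {V : quantaleType d}.
Variables (T : monad) (tau : monad_morphism (pv_monad V) T).

Definition tau_alg (X : Type) : pv_obj V (T X) -> T X :=
  mmult T \o @mtrans _ _ tau (T X).

Lemma tau_algP X : @is_algebra (pv_monad V) (T X) (@tau_alg X).
Proof.
split.
  by rewrite /tau_alg -compA mtrans_unit mmult_unitl.
apply/funext => r; rewrite /tau_alg.
have /(congr1 (@^~ r)) := mtrans_mult tau (T X).
have /(congr1 (@^~ r)) := mtrans_nat tau (mmult T \o @mtrans _ _ tau (T X)).
have /(congr1 (@^~ (mmap T (@mtrans _ _ tau (T X)) (@mtrans _ _ tau _ r)))) :=
  mmult_assoc T X.
by rewrite (mmap_comp T) /= => assoc <- ->.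
Qed.

Definition tle (X : Type) (x y : T X) : Prop := alg_le (@tau_alg X) x y.

Definition tact (X : Type) (x : T X) (v : V) : T X := alg_act (@tau_alg X) x v.

Definition power_enriched : Prop :=
  forall (X Y : Type) (f g : X -> T Y),
    (forall x, tle (f x) (g x)) ->
    forall t : T X, tle (mmult T (mmap T f t)) (mmult T (mmap T g t)).

Definition tbracket (X : Type) (x y : T X) : V := qsup [set v | tle (tact x v) y].

(* Elements of [pv_obj V X] take an extra argument in [unit], the singleton 1. *)
Definition vflat (X Y : Type) (r : vrel V X Y) : Y -> pv_obj V X :=
  fun y x _ => r x y.

Definition kleisli_lift (X Y : Type) (r : vrel V X Y) : T Y -> T X :=
  mmult T \o mmap T (@mtrans _ _ tau X \o vflat r).

Definition kleisli_ext (X Y : Type) (r : vrel V X Y) : vrel V (T X) (T Y) :=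
  fun x y => tbracket x (kleisli_lift r y).

End PowerEnriched.

Record is_lax_extension d (V : quantaleType d) (T : monad)
    (That : forall X Y, vrel V X Y -> vrel V (T X) (T Y)) : Prop := IsLaxExtension {
  lax_mono : forall X Y (r r' : vrel V X Y),
    vrel_le r r' -> vrel_le (That X Y r) (That X Y r');
  lax_op : forall Y Z (f : Z -> Y),
    vrel_le (vop (vgraph (mmap T f))) (That Y Z (vop (vgraph f)));
  lax_op_comp : forall X Y Z (r : vrel V X Y) (f : Z -> Y),
    That X Z (vcomp (vop (vgraph f)) r) =
    vcomp (vop (vgraph (mmap T f))) (That X Y r);
  lax_comp : forall X Y Z (r : vrel V X Y) (s : vrel V Y Z),
    vrel_le (vcomp (That Y Z s) (That X Y r)) (That X Z (vcomp s r));
  lax_mult : forall X Y (r : vrel V X Y),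
    vrel_le (vcomp (That (T X) (T Y) (That X Y r)) (vop (vgraph (@mmult T X))))
            (vcomp (vop (vgraph (@mmult T Y))) (That X Y r));
  lax_unit : forall X Y (r : vrel V X Y),
    vrel_le (vcomp r (vop (vgraph (@munit T X))))
            (vcomp (vop (vgraph (@munit T Y))) (That X Y r))
}.

(* Main.v *)
Require Import Defs.
From mathcomp Require Import all_boot all_order.
From mathcomp Require Import boolp classical_sets.

(** Every free algebra [T X] is a complete lattice with a right action of [V],
    and the bracket [tbracket x] is right adjoint to the action [tact x]:
    [v <= tbracket x y] iff [tle (tact x v) y] ([tact_tbracketP]).  So a value
    of the Kleisli extension is determined by [kleisli_lift tau r : T Y -> T X],
    and every axiom becomes a statement about such maps.

    A relation [r] from [X] to [Y] is a map from [Y] to [pv_obj V X], that is,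
    a Kleisli arrow of the powerset monad, and [kleisli_lift tau r] is the
    Kleisli extension of its image under [tau].  As [tau] is a monad morphism,
    [kleisli_lift] is functorial: it sends [vcomp s r] to the composite of the
    lifts of [r] and [s] ([kleisli_lift_comp]), and the opposite of the graph
    of [f] to [mmap T f] ([kleisli_lift_op]).  Moreover [kleisli_lift tau r] is a
    morphism of [T]-algebras, hence of algebras for the powerset monad
    ([bind_hom]): it is monotone and commutes with the action.

    For [vcomp s r] this gives, by adjunction, the inequality
    [r^ x y * s^ y z <= (s r)^ x z], with hats for the Kleisli extension.  The
    converse holds because the supremum over [y] includes
    [y = kleisli_lift tau s z], for which [s^ y z] is above the unit.

    Power-enrichment enters twice: for monotonicity, and for the
    multiplication axiom, where the relation [kleisli_ext tau r] is itself
    lifted.  There the supremum over [x] of the [x * r^ x y] is at most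
    [kleisli_lift tau r y], and this inequality between maps on [T Y] has to
    persist after Kleisli extension to [T (T Y)] ([mmult_kleisli_lift_le]). *)

Set Implicit Arguments.
Unset Strict Implicit.
Unset Printing Implicit Defensive.

Import Order.TTheory.
Local Open Scope order_scope.
Local Open Scope classical_set_scope.

(** * Algebras for the powerset monad *)

Section Algebras.
Context {d : Order.disp_t} {V : quantaleType d}.

Lemma le_qmull (w u v : V) : (u <= v)%O -> (qmul w u <= qmul w v)%O.
Proof.
move=> uv; have <- : qsup [set u; v] = v.
  by apply: qsup_eq => [z [->|->]//|z]; apply; right.
by rewrite qmul_supr; apply: qsup_ub; exists u; [left|].
Qed.

Section OneAlgebra.
Context (X : Type) (a : pv_obj V X -> X).
Hypothesis aP : @is_algebra (pv_monad V) X a.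

Lemma le_alg_act (x y : X) (u v : V) :
  alg_le a x y -> (u <= v)%O -> alg_le a (alg_act a x u) (alg_act a y v).
Proof.
move=> xy uv; apply: (@alg_le_trans _ _ _ _ aP _ (alg_act a x v)).
  (* [v] is the supremum of the pair [u, v], and the action preserves it. *)
  have <- : qsup [set u; v] = v.
    by apply: qsup_eq => [w [->|->]//|w]; apply; right.
  by case: (algebra_act_supr aP x [set u; v]) => ub _; apply: ub; exists u; [left|].
have lubxy : is_lub (alg_le a) [set x; y] y.
  split=> [z [->|->]//|z]; last by apply; right.
  exact: alg_le_refl.
by case: (algebra_act_supl aP v lubxy) => ub _; apply: ub; exists x; [left|].
Qed.

Lemma le_algebra (phi psi : pv_obj V X) :
  (forall x, phi x tt <= psi x tt)%O -> alg_le a (a phi) (a psi).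
Proof.
move=> le_phi; case: (algebra_lub aP phi) => _; apply => _ [x _ <-].
apply: (@alg_le_trans _ _ _ _ aP _ (alg_act a x (psi x tt))).
  by apply: le_alg_act => //; exact: alg_le_refl.
by case: (algebra_lub aP psi) => ub _; apply: ub; exists x.
Qed.

(** The action is residuated in its second argument since it preserves the
    suprema of [V]. *)
Lemma alg_act_residual (x y : X) (v : V) :
  alg_le a (alg_act a x v) y <-> (v <= qsup [set w | alg_le a (alg_act a x w) y])%O.
Proof.
split=> [xvy|le_v]; first exact: qsup_ub.
set W := [set w | _] in le_v.
apply: (@alg_le_trans _ _ _ _ aP _ (alg_act a x (qsup W))).
  by apply: le_alg_act => //; exact: alg_le_refl.
by case: (algebra_act_supr aP x W) => _; apply => _ [w Ww <-].
Qed.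

End OneAlgebra.

Section Homomorphisms.
Context (X Y : Type) (a : pv_obj V X -> X) (b : pv_obj V Y -> Y) (h : X -> Y).
Hypothesis hP : h \o a = b \o pv_map h.

(** Each supremum is a value of the structure map, at the characteristic
    function of a set, and [pv_map h] sends the characteristic function of [A]
    to that of the image. *)
Lemma alg_hom_sup (A : set X) : h (alg_sup a A) = alg_sup b [set h x | x in A].
Proof.
rewrite /alg_sup -[LHS]/((h \o a) _) hP /=; congr b; apply: vrelP => y [].
rewrite /pv_map /vcomp /vop /vgraph; case: asboolP => [[x Ax <-]|nhA].
  apply: qsup_eq => [_ [z _ <-]|u].
    case: ifP => _; rewrite ?qmul0q ?le0x // qmul1q.
    by case: ifP => _; rewrite ?lexx ?le0x.
  by apply; exists x => //; rewrite !asboolT // qmul1q.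
apply: qsup_eq => [_ [z _ <-]|u _]; last exact: le0x.
case: asboolP => [hz|]; rewrite ?qmul0q // asboolF ?qmulq0 // => Az.
by apply: nhA; exists z.
Qed.

Lemma alg_hom_le (x y : X) : alg_le a x y -> alg_le b (h x) (h y).
Proof. by rewrite /alg_le => {2}<-; rewrite alg_hom_sup image_setU !image_set1. Qed.

Lemma alg_hom_act (x : X) (v : V) : h (alg_act a x v) = alg_act b (h x) v.
Proof.
rewrite /alg_act -[LHS]/((h \o a) _) hP /=; congr b; apply: vrelP => y [].
rewrite /pv_map /vcomp (@qsup_range_single _ _ _ _ x); last first.
  by move=> z zx; rewrite asboolF // qmulq0.
rewrite asboolT // /vop /vgraph; case: asboolP => [->|hxy].
  by rewrite asboolT // qmul1q.
by rewrite asboolF ?qmul0q // => /esym.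
Qed.

End Homomorphisms.

Lemma le_pv_map (X Y : Type) (f : X -> Y) (phi psi : pv_obj V X) :
  (forall x, phi x tt <= psi x tt)%O ->
  forall y, (pv_map f phi y tt <= pv_map f psi y tt)%O.
Proof.
move=> le_phi y; apply: qsup_le => _ [x _ <-].
apply: (@le_trans _ _ (qmul (vop (vgraph f) y x) (psi x tt))).
  exact: le_qmull.
by apply: qsup_ub; exists x.
Qed.

End Algebras.

(** * Kleisli extension of maps *)

Section Bind.
Variable T : monad.

Definition bind (X Y : Type) (f : X -> T Y) : T X -> T Y :=
  mmult T \o mmap T f.

Lemma bind_unit (X Y : Type) (f : X -> T Y) (x : X) : bind f (munit T x) = f x.
Proof.
rewrite /bind /= -[mmap T f _]/((mmap T f \o munit T) x) munit_nat /=.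
by rewrite -[LHS]/((mmult T \o munit T) (f x)) mmult_unitl.
Qed.

Lemma bind_mult (X Y : Type) (f : X -> T Y) :
  bind f \o mmult T = mmult T \o mmap T (bind f).
Proof.
rewrite /bind -compA (mmult_nat T f) compA mmult_assoc -compA.
by rewrite -(mmap_comp T).
Qed.

Lemma bind_comp (X Y Z : Type) (g : Y -> T Z) (f : X -> T Y) :
  bind (bind g \o f) = bind g \o bind f.
Proof.
rewrite [in RHS]/(bind f) compA bind_mult -compA -(mmap_comp T).
by [].
Qed.

Lemma bind_munit_comp (X Y : Type) (f : X -> Y) :
  bind (munit T \o f) = mmap T f.
Proof. by rewrite /bind (mmap_comp T) compA mmult_unitr. Qed.

End Bind.

(** * The order and the action on free algebras *)

Section PowerEnrichedMonad.
Context {d : Order.disp_t} {V : quantaleType d}.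
Variables (T : monad) (tau : monad_morphism (pv_monad V) T).

Local Notation alg X := (@tau_alg d V T tau X).

Lemma tact_tbracketP (X : Type) (x y : T X) (v : V) :
  tle tau (tact tau x v) y <-> (v <= tbracket tau x y)%O.
Proof. exact: (alg_act_residual (tau_algP tau X)). Qed.

Lemma tact_one (X : Type) (x : T X) : tact tau x qone = x.
Proof. exact: (vmodule_act_one (algebra_vmodule (tau_algP tau X))). Qed.

Lemma tact_mul (X : Type) (x : T X) (u v : V) :
  tact tau x (qmul u v) = tact tau (tact tau x u) v.
Proof. exact: (vmodule_act_mul (algebra_vmodule (tau_algP tau X))). Qed.

Lemma tle_refl (X : Type) (x : T X) : tle tau x x.
Proof. exact: (alg_le_refl (tau_algP tau X)). Qed.

Lemma tle_trans (X : Type) (y x z : T X) :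
  tle tau x y -> tle tau y z -> tle tau x z.
Proof. exact: (alg_le_trans (tau_algP tau X)). Qed.

Lemma le_tbracketr (X : Type) (x y y' : T X) :
  tle tau y y' -> (tbracket tau x y <= tbracket tau x y')%O.
Proof.
move=> yy'; apply/tact_tbracketP; apply: tle_trans yy'.
by apply/tact_tbracketP; exact: lexx.
Qed.

Lemma one_le_tbracket (X : Type) (x : T X) : (qone <= tbracket tau x x)%O.
Proof. by apply/tact_tbracketP; rewrite tact_one; exact: tle_refl. Qed.

(** Kleisli extensions are morphisms of free [T]-algebras, and [tau] turns
    morphisms of [T]-algebras into morphisms of powerset algebras by
    naturality. *)
Lemma bind_hom (X Y : Type) (f : X -> T Y) :
  bind f \o alg X = alg Y \o pv_map (bind f).
Proof.
apply/funext => z /=.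
rewrite /tau_alg -[LHS]/((bind f \o mmult T) _) bind_mult /=; congr mmult.
exact: (congr1 (@^~ z) (mtrans_nat tau (bind f))).
Qed.

Lemma bind_tle (X Y : Type) (f : X -> T Y) (x y : T X) :
  tle tau x y -> tle tau (bind f x) (bind f y).
Proof. exact: (alg_hom_le (bind_hom f)). Qed.

Lemma bind_tact (X Y : Type) (f : X -> T Y) (x : T X) (v : V) :
  bind f (tact tau x v) = tact tau (bind f x) v.
Proof. exact: (alg_hom_act (bind_hom f)). Qed.

(** Naturality and the right unit law exhibit [tau phi] as the supremum of the
    elements [munit T x * phi x], so that the order-theoretic properties of
    [tau] follow from those of the structure map. *)
Lemma tau_munit (X : Type) (phi : pv_obj V X) :
  @mtrans _ _ tau X phi = alg X (pv_map (@munit T X) phi).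
Proof.
rewrite /tau_alg -[pv_map _]/(mmap (pv_monad V) (@munit T X)) /=.
have /(congr1 (@^~ phi)) /= <- := mtrans_nat tau (@munit T X).
by rewrite -[RHS]/((mmult T \o mmap T (@munit T X)) _) mmult_unitr.
Qed.

Lemma tau_mono (X : Type) (phi psi : pv_obj V X) :
  (forall x, phi x tt <= psi x tt)%O ->
  tle tau (@mtrans _ _ tau X phi) (@mtrans _ _ tau X psi).
Proof.
move=> le_phi; rewrite !tau_munit.
by apply: (le_algebra (tau_algP tau X)); exact: le_pv_map.
Qed.

Lemma tact_munit_le (X : Type) (phi : pv_obj V X) (x : X) :
  tle tau (tact tau (munit T x) (phi x tt)) (@mtrans _ _ tau X phi).
Proof.
rewrite tau_munit.
have [ub _] := algebra_lub (tau_algP tau X) (pv_map (@munit T X) phi).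
apply: tle_trans (ub _ (ex_intro2 _ _ (munit T x) I erefl)).
apply: (le_alg_act (tau_algP tau X)); first exact: tle_refl.
apply: qsup_ub; exists x => //.
by rewrite /vop /vgraph asboolT // qmul1q.
Qed.

(** * Lifts of relations *)

Lemma kleisli_liftE (X Y : Type) (r : vrel V X Y) :
  kleisli_lift tau r = bind (@mtrans _ _ tau X \o vflat r).
Proof. by []. Qed.

(** Composition of relations is Kleisli composition for the powerset monad,
    and [tau] preserves Kleisli composition. *)
Lemma kleisli_lift_comp (X Y Z : Type) (r : vrel V X Y) (s : vrel V Y Z) :
  kleisli_lift tau (vcomp s r) = kleisli_lift tau r \o kleisli_lift tau s.
Proof.
rewrite !kleisli_liftE -bind_comp; congr bind; apply/funext => z /=.
have -> : vflat (vcomp s r) z = pv_mult (pv_map (vflat r) (vflat s z)).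
  rewrite /pv_mult /pv_map -vcompA; apply: vrelP => x [].
  by apply: eq_qsup_range => y; rewrite pv_ev_op.
have /(congr1 (@^~ (pv_map (vflat r) (vflat s z)))) /= -> := mtrans_mult tau X.
have /(congr1 (@^~ (vflat s z))) /= <- := mtrans_nat tau (vflat r).
by rewrite /bind (mmap_comp T).
Qed.

Lemma kleisli_lift_op (Y Z : Type) (f : Z -> Y) :
  kleisli_lift tau (vop (vgraph f) : vrel V Y Z) = mmap T f.
Proof.
rewrite kleisli_liftE -bind_munit_comp -(mtrans_unit tau).
by congr bind; apply/funext.
Qed.

(** * The Kleisli extension of relations *)

Lemma kleisli_ext_mono (tauP : power_enriched tau) (X Y : Type)
    (r r' : vrel V X Y) :
  vrel_le r r' -> vrel_le (kleisli_ext tau r) (kleisli_ext tau r').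
Proof.
move=> rr' x y; apply: le_tbracketr; apply: tauP => {}y.
by apply: tau_mono => {}x; exact: rr'.
Qed.

Lemma kleisli_ext_comp (X Y Z : Type) (r : vrel V X Y) (s : vrel V Y Z) :
  kleisli_ext tau (vcomp s r) = vcomp (kleisli_ext tau s) (kleisli_ext tau r).
Proof.
apply: vrelP => x z; rewrite /kleisli_ext kleisli_lift_comp /=.
apply/eqP; rewrite eq_le; apply/andP; split.
  (* The term of the supremum at the lift of [z] is already large enough. *)
  set y := kleisli_lift tau s z.
  apply: (@le_trans _ _
    (qmul (tbracket tau x (kleisli_lift tau r y)) (tbracket tau y y)));
    last by apply: qsup_ub; exists y.
  by rewrite -{1}[tbracket _ _ _]qmulq1; exact/le_qmull/one_le_tbracket.
apply: qsup_le => _ [y _ <-]; apply/tact_tbracketP; rewrite tact_mul.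
apply: (@tle_trans _ (tact tau (kleisli_lift tau r y)
                        (tbracket tau y (kleisli_lift tau s z)))).
  apply: (le_alg_act (tau_algP tau X)) => //.
  by apply/tact_tbracketP; exact: lexx.
rewrite kleisli_liftE -bind_tact; apply: bind_tle.
by apply/tact_tbracketP; exact: lexx.
Qed.

Lemma kleisli_ext_op_comp (X Y Z : Type) (r : vrel V X Y) (f : Z -> Y) :
  kleisli_ext tau (vcomp (vop (vgraph f)) r) =
  vcomp (vop (vgraph (mmap T f))) (kleisli_ext tau r).
Proof.
apply: vrelP => x z.
by rewrite vcomp_opl /kleisli_ext kleisli_lift_comp kleisli_lift_op.
Qed.

Lemma kleisli_ext_op (Y Z : Type) (f : Z -> Y) :
  vrel_le (vop (vgraph (mmap T f))) (kleisli_ext tau (vop (vgraph f))).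
Proof.
move=> y z; rewrite /kleisli_ext kleisli_lift_op /vop /vgraph.
by case: asboolP => [->|_]; [exact: one_le_tbracket|exact: le0x].
Qed.

(** The supremum over [x] of the elements [x * tbracket x (kleisli_lift tau r y)]
    is at most [kleisli_lift tau r y], by adjunction. *)
Lemma tau_alg_kleisli_ext_le (X Y : Type) (r : vrel V X Y) (y : T Y) :
  tle tau (alg X (vflat (kleisli_ext tau r) y)) (kleisli_lift tau r y).
Proof.
case: (algebra_lub (tau_algP tau X) (vflat (kleisli_ext tau r) y)) => _.
by apply => _ [x _ <-]; apply/tact_tbracketP; exact: lexx.
Qed.

(** The left side is the Kleisli extension at [t] of the map whose value at [y]
    is the supremum in [tau_alg_kleisli_ext_le]; the right side is the Kleisli
    extension at [t] of [kleisli_lift tau r].  Power-enrichment compares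
    them. *)
Lemma mmult_kleisli_lift_le (tauP : power_enriched tau) (X Y : Type)
    (r : vrel V X Y) (t : T (T Y)) :
  tle tau (mmult T (kleisli_lift tau (kleisli_ext tau r) t))
    (kleisli_lift tau r (mmult T t)).
Proof.
have bind_id : mmult T = bind (@idfun (T X)) by rewrite /bind mmap_id.
rewrite [X in tle _ X _](_ : _ =
    bind (fun y => alg X (vflat (kleisli_ext tau r) y)) t); last first.
  rewrite bind_id kleisli_liftE.
  rewrite -[LHS]/((bind idfun \o bind (@mtrans _ _ tau _ \o vflat _)) t).
  by rewrite -bind_comp -bind_id.
rewrite [X in tle _ _ X](_ : _ = bind (kleisli_lift tau r) t).
  by apply: tauP => y; exact: tau_alg_kleisli_ext_le.
by rewrite kleisli_liftE -[LHS]/((bind _ \o mmult T) t) bind_mult.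
Qed.

Lemma kleisli_ext_mult (tauP : power_enriched tau) (X Y : Type)
    (r : vrel V X Y) :
  vrel_le (vcomp (kleisli_ext tau (kleisli_ext tau r)) (vop (vgraph (@mmult T X))))
    (vcomp (vop (vgraph (@mmult T Y))) (kleisli_ext tau r)).
Proof.
move=> x t; rewrite vcomp_opl; apply: qsup_le => _ [u _ <-].
rewrite /vop /vgraph; case: asboolP => [<-|_]; last by rewrite qmul0q le0x.
rewrite qmul1q; apply/tact_tbracketP.
apply: tle_trans (mmult_kleisli_lift_le tauP r t).
(* The multiplication is the Kleisli extension of an identity, hence a morphism. *)
have -> : mmult T = bind (@idfun (T X)) by rewrite /bind mmap_id.
rewrite -bind_tact; apply: bind_tle.
by apply/tact_tbracketP; exact: lexx.
Qed.

Lemma kleisli_ext_unit (X Y : Type) (r : vrel V X Y) :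
  vrel_le (vcomp r (vop (vgraph (@munit T X))))
    (vcomp (vop (vgraph (@munit T Y))) (kleisli_ext tau r)).
Proof.
move=> t y; rewrite vcomp_opl; apply: qsup_le => _ [x _ <-].
rewrite /vop /vgraph; case: asboolP => [<-|_]; last by rewrite qmul0q le0x.
rewrite qmul1q; apply/tact_tbracketP; rewrite kleisli_liftE bind_unit.
exact: (tact_munit_le (vflat r y)).
Qed.

End PowerEnrichedMonad.

Theorem proposition3p5p1 (d : Order.disp_t) (V : quantaleType d) (T : monad)
    (tau : monad_morphism (pv_monad V) T) (tauP : power_enriched tau) :
  is_lax_extension (@kleisli_ext d V T tau) /\
  (forall (X Y Z : Type) (r : vrel V X Y) (s : vrel V Y Z),
     kleisli_ext tau (vcomp s r) = vcomp (kleisli_ext tau s) (kleisli_ext tau r)).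
Proof.
split; last exact: kleisli_ext_comp.
split.
- by move=> X Y r r'; exact: kleisli_ext_mono.
- by move=> Y Z f; exact: kleisli_ext_op.
- by move=> X Y Z r f; exact: kleisli_ext_op_comp.
- by move=> X Y Z r s x z; rewrite kleisli_ext_comp lexx.
- by move=> X Y r; exact: kleisli_ext_mult.
- by move=> X Y r; exact: kleisli_ext_unit.
Qed.
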